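(* Let $t \geq 2$ be an integer. Then, as $n \to \infty$, $$ex\bigl(n, n^{\frac{t+2}{2t+1}}, \{C_4, \theta_{3,t}\}\bigr) = \Theta\bigl(n^{1+\frac{1}{2t+1}}\bigr).$$ That is, there exist constants $c_1, c_2 > 0$ (depending only on $t$) and $n_0$ such that for all integers $n \geq n_0$, $$c_1 n^{1+\frac{1}{2t+1}} \leq ex\bigl(n, \lfloor n^{\frac{t+2}{2t+1}} \rfloor, \{C_4, \theta_{3,t}\}\bigr) \leq c_2 n^{1+\frac{1}{2t+1}}.$$
   Context: For a family $\mathcal{F}$ of graphs, $ex(a,b,\mathcal{F})$ is the maximum number of edges in a bipartite graph whose part sizes are $a$ and $b$ and which contains no graph in $\mathcal{F}$ as a (not necessarily induced) subgraph. $C_4$ is the cycle of length 4. $\theta_{3,t}$ is the theta graph consisting of two vertices joined by $t$ internally vertex-disjoint paths, each with exactly 3 edges. When a part size is given by a non-integer real number, it is rounded down to an integer. *)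

(* Defs.v *)
From HB Require Import structures.
From mathcomp Require Import all_boot all_order all_algebra.
From mathcomp Require Import all_classical reals exp.

Set Implicit Arguments.
Unset Strict Implicit.
Unset Printing Implicit Defensive.

Record sgraph := SGraph {
  vertex :> finType;
  adj : rel vertex;
  adj_sym : symmetric adj;
  adj_irr : irreflexive adj
}.

(* Not necessarily induced: [f] need not reflect adjacency. *)
Definition subgraph (H G : sgraph) : Prop :=
  exists f : H -> G, injective f /\ forall x y, adj x y -> adj (f x) (f y).

(* Families are bare predicates: [set sgraph] is universe-inconsistent, [sgraph]
   being a large type. *)
Definition free_of (F : sgraph -> Prop) (G : sgraph) : Prop :=
  forall H, F H -> ~ subgraph H G.

Section Bipartite.
Variables (a b : nat) (E : {set 'I_a * 'I_b}).

Definition bip_adj : rel ('I_a + 'I_b)%type := fun u v =>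
  match u, v with
  | inl i, inr j => (i, j) \in E
  | inr j, inl i => (i, j) \in E
  | _, _ => false
  end.

Lemma bip_adj_sym : symmetric bip_adj.
Proof. by case=> i [] j. Qed.

Lemma bip_adj_irr : irreflexive bip_adj.
Proof. by case. Qed.

Definition bip_graph : sgraph := SGraph bip_adj_sym bip_adj_irr.

End Bipartite.

(* The edges of [bip_graph E] are in bijection with [E].  The maximum ranges
   over a nonempty set whenever every graph of [F] has an edge. *)
Definition ex (a b : nat) (F : sgraph -> Prop) : nat :=
  \max_(E : {set 'I_a * 'I_b} | `[< free_of F (bip_graph E) >]) #|E|.

Definition C4_adj : rel 'I_4 := fun i j => (j == ordS i) || (i == ordS j).

Lemma C4_adj_sym : symmetric C4_adj.
Proof. by move=> i j; rewrite /C4_adj orbC. Qed.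

Lemma C4_adj_irr : irreflexive C4_adj.
Proof. by case=> [[|[|[|[|i]]]] Hi]. Qed.

Definition C4 : sgraph := SGraph C4_adj_sym C4_adj_irr.

Section Theta3.
Variable t : nat.

(* [inl false] and [inl true] are the two end vertices; the [i]-th path is
   [inl false], [inr (i, false)], [inr (i, true)], [inl true]. *)
Definition theta3_adj : rel (bool + 'I_t * bool)%type := fun u v =>
  match u, v with
  | inl _, inl _ => false
  | inl e, inr (_, c) => e == c
  | inr (_, c), inl e => e == c
  | inr (i, c), inr (j, d) => (i == j) && (c != d)
  end.

Lemma theta3_adj_sym : symmetric theta3_adj.
Proof.
case=> [e|[i c]] [e'|[j d]] //=.
by rewrite [i == j]eq_sym [c == d]eq_sym.
Qed.

Lemma theta3_adj_irr : irreflexive theta3_adj.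
Proof. by case=> [e|[i c]] //=; rewrite !eqxx. Qed.

Definition theta3 : sgraph := SGraph theta3_adj_sym theta3_adj_irr.

End Theta3.

Definition C4_theta3 (t : nat) : sgraph -> Prop :=
  fun H => H = C4 \/ H = theta3 t.

(* Main.v *)
(* Upper bound: when there is no C4, distinct 3-edge paths between two given
   vertices on opposite sides are internally disjoint, so excluding theta_{3,t}
   leaves at most t-1 of them per pair.  After discarding the edges at vertices
   of degree at most da (left) or db (right), each remaining edge is the middle
   of at least da * db such paths; take da ~ x and db ~ x^t with x = n^(1/(2t+1)).

   Lower bound: let q = 2^k and let N be the norm of F_{q^t} over F_q.  Join a
   point of F_q^{t+2} = F_q * F_{q^t} * F_q to the lines through it with
   direction (1, y, N y).  Two lines meet at most once.  The other lines of the
   family through a point P that meet a given line l not containing P lie in the plane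
   of P and l, so their directions lie, with that of l, on a common affine line.
   Restricted to that line the equation z = N y has degree t, since N vanishes
   only at 0; hence there are at most t - 1 such lines, one fewer than a
   theta_{3,t} needs. *)

Require Import Defs.
From mathcomp Require Import all_boot all_order all_algebra all_field.
From mathcomp Require Import all_classical reals exp ring zify.
Import Order.TTheory GRing.Theory Num.Theory.
Local Open Scope ring_scope.

(** * Forbidden subgraphs as conditions on an edge set *)

Definition rectangle_free {A B : finType} (E : {set A * B}) : Prop :=
  forall i i' j j', i != i' -> j != j' ->
    (i, j) \in E -> (i, j') \in E -> (i', j) \in E -> (i', j') \in E -> False.

(** The ends lie on opposite sides since a 3-edge path has odd length. Vertices on different sides
    are distinct automatically, so only same-side inequalities are required. *)
Definition three_path_free (t : nat) {A B : finType} (E : {set A * B}) : Prop :=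
  forall (i : A) (j : B) (u : 'I_t -> B) (v : 'I_t -> A),
    injective u -> injective v ->
    (forall k, u k != j) -> (forall k, v k != i) ->
    (forall k, [/\ (i, u k) \in E, (v k, u k) \in E & (v k, j) \in E]) -> False.

Lemma free_of_rectangle_free t a b (E : {set 'I_a * 'I_b}) :
  free_of (C4_theta3 t) (bip_graph E) -> rectangle_free E.
Proof.
move=> free i i' j j' ii' jj' e1 e2 e3 e4.
apply: (free C4 (or_introl erefl)).
pose f (k : 'I_4) : 'I_a + 'I_b :=
  match val k with 0 => inl i | 1 => inr j | 2 => inl i' | _ => inr j' end.
have ne : [/\ i == i' = false, i' == i = false,
             j == j' = false & j' == j = false].
  by split; apply/negbTE; rewrite // eq_sym.
case: ne => n1 n2 n3 n4.
exists f; split.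
- move=> [[|[|[|[|k]]]] Hk] [[|[|[|[|l]]]] Hl] //= /eqP;
  rewrite /f /eq_op /= ?n1 ?n2 ?n3 ?n4 //;
  by move=> _; apply: val_inj.
- by move=> [[|[|[|[|k]]]] Hk] [[|[|[|[|l]]]] Hl].
Qed.

Lemma free_of_three_path_free t a b (E : {set 'I_a * 'I_b}) :
  free_of (C4_theta3 t) (bip_graph E) -> three_path_free t E.
Proof.
move=> free i j u v uI vI uj vi euv.
apply: (free (theta3 t) (or_intror erefl)).
pose f (w : bool + 'I_t * bool) : 'I_a + 'I_b :=
  match w with
  | inl false => inl i | inl true => inr j
  | inr (k, false) => inr (u k) | inr (k, true) => inl (v k)
  end.
exists f; split.
- move=> [[]|[k []]] [[]|[l []]] //= [].
  + by move=> e; have := uj l; rewrite e eqxx.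
  + by move=> e; have := vi l; rewrite e eqxx.
  + by move=> e; have := vi k; rewrite e eqxx.
  + by move/vI->.
  + by move=> e; have := uj k; rewrite e eqxx.
  + by move/uI->.
- move=> [[]|[k []]] [[]|[l []]] //=; rewrite ?andbF ?andbT //.
  + by case: (euv l).
  + by case: (euv l).
  + by case: (euv k).
  + by move/eqP<-; case: (euv k).
  + by case: (euv k).
  + by move/eqP<-; case: (euv k).
Qed.

Lemma free_of_C4_theta3 t a b (E : {set 'I_a * 'I_b}) : (0 < t)%N ->
  rectangle_free E -> three_path_free t E ->
  free_of (C4_theta3 t) (bip_graph E).
Proof.
move=> t0 rf tf H [->|->] [f [fI fA]].
- have E01 : adj (f (inord 0)) (f (inord 1)).
    by apply: fA; rewrite /= /C4_adj -!val_eqE /= !inordK.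
  have E12 : adj (f (inord 1)) (f (inord 2)).
    by apply: fA; rewrite /= /C4_adj -!val_eqE /= !inordK.
  have E23 : adj (f (inord 2)) (f (inord 3)).
    by apply: fA; rewrite /= /C4_adj -!val_eqE /= !inordK.
  have E30 : adj (f (inord 3)) (f (inord 0)).
    by apply: fA; rewrite /= /C4_adj -!val_eqE /= !inordK.
  have N02 : f (inord 0) != f (inord 2).
    by apply/eqP => /fI/(congr1 val); rewrite /= !inordK.
  have N13 : f (inord 1) != f (inord 3).
    by apply/eqP => /fI/(congr1 val); rewrite /= !inordK.
  case: (f (inord 0)) (f (inord 1)) (f (inord 2)) (f (inord 3))
    E01 E12 E23 E30 N02 N13 => [i|i] [j|j] [k|k] [l|l] //= e1 e2 e3 e4 n1 n2.
  + by apply: (rf i k j l).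
  + by apply: (rf j l i k).
- pose k0 := Ordinal t0.
  have adj0 k : adj (f (inl false)) (f (inr (k, false))) by exact: fA.
  have adj1 k : adj (f (inr (k, false))) (f (inr (k, true))).
    by apply: fA; rewrite /= eqxx.
  have adj2 k : adj (f (inr (k, true))) (f (inl true)) by exact: fA.
  have inj c : injective (fun k => f (inr (k, c))) by move=> k l /fI [].
  have ne c d k : f (inr (k, c)) != f (inl d) by apply/eqP => /fI.
  case E0 : (f (inl false)) adj0 ne => [i|j] adj0 ne;
  case E1 : (f (inl true)) adj2 ne => [i'|j'] adj2 ne.
  (* Ends on the same side are impossible: path [k0], present as [0 < t], has odd length. *)
  + by case: (f _) (f _) (adj0 k0) (adj1 k0) (adj2 k0) => [?|?] [?|?].
  + have /fin_all_exists[u uE] k : exists u, f (inr (k, false)) = inr u.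
      by case: (f _) (adj0 k) => // u; exists u.
    have /fin_all_exists[v vE] k : exists v, f (inr (k, true)) = inl v.
      by case: (f _) (adj2 k) => // v; exists v.
    apply: (tf i j' u v).
    * by move=> k l ukl; apply: (inj false); rewrite !uE ukl.
    * by move=> k l ukl; apply: (inj true); rewrite !vE ukl.
    * by move=> k; have := ne false true k; rewrite uE E1.
    * by move=> k; have := ne true false k; rewrite vE E0.
    * move=> k; have := (adj0 k, adj1 k, adj2 k).
      by rewrite uE vE /= => -[[-> ->] ->].
  (* The first end is now on the right, so the paths are read backwards. *)
  + have /fin_all_exists[u uE] k : exists u, f (inr (k, true)) = inr u.
      by case: (f _) (adj2 k) => // u; exists u.
    have /fin_all_exists[v vE] k : exists v, f (inr (k, false)) = inl v.
      by case: (f _) (adj0 k) => // v; exists v.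
    apply: (tf i' j u v).
    * by move=> k l ukl; apply: (inj true); rewrite !uE ukl.
    * by move=> k l ukl; apply: (inj false); rewrite !vE ukl.
    * by move=> k; have := ne true false k; rewrite uE E0.
    * by move=> k; have := ne false true k; rewrite vE E1.
    * move=> k; have := (adj0 k, adj1 k, adj2 k).
      by rewrite uE vE /= => -[[-> ->] ->].
  + by case: (f _) (f _) (adj0 k0) (adj1 k0) (adj2 k0) => [?|?] [?|?].
Qed.

(** Indices outside the images of [f] and [g] become isolated vertices, so a construction may live
    on any finite types that fit. *)
Lemma ex_ge_card t (A B : finType) (E : {set A * B}) a b : (0 < t)%N ->
  (#|A| <= a)%N -> (#|B| <= b)%N ->
  rectangle_free E -> three_path_free t E ->
  (#|E| <= ex a b (C4_theta3 t))%N.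
Proof.
move=> t0 Aa Bb rf tf.
pose f (i : A) : 'I_a := widen_ord Aa (enum_rank i).
pose g (j : B) : 'I_b := widen_ord Bb (enum_rank j).
have fI : injective f by move=> i j /(congr1 val) /= /val_inj/enum_rank_inj.
have gI : injective g by move=> i j /(congr1 val) /= /val_inj/enum_rank_inj.
pose h (e : A * B) := (f e.1, g e.2).
have hI : injective h.
  by move=> [i j] [k l] e; congr (_, _);
    [apply/fI/(congr1 fst e) | apply/gI/(congr1 snd e)].
have hE i j : (f i, g j) \in [set h e | e in E] = ((i, j) \in E).
  exact: (mem_imset _ (i, j) hI).
have hP i j : (i, j) \in [set h e | e in E] ->
    exists i0 j0, i = f i0 /\ j = g j0.
  by case/imsetP => -[i0 j0] _ [-> ->]; exists i0, j0.
rewrite -(card_imset _ hI) /ex.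
apply: (leq_bigmax_cond (F := fun E0 : {set 'I_a * 'I_b} => #|E0|)).
apply/asboolP; apply: free_of_C4_theta3 => //.
- move=> i i' j j' ii' jj' e1 e2 e3 e4.
  have [i0 [j0 [Ei Ej]]] := hP _ _ e1; have [i1 [j1 [Ei' Ej']]] := hP _ _ e4.
  move: ii' jj' e1 e2 e3 e4; rewrite {}Ei {}Ej {}Ei' {}Ej' !hE !inj_eq //.
  exact: rf.
- move=> i j u v uI vI uj vi euv.
  have [i0 [_ [Ei _]]] : exists i0 j0, i = f i0 /\ u (Ordinal t0) = g j0.
    by apply: hP; case: (euv (Ordinal t0)).
  have [_ [j0 [_ Ej]]] : exists i0 j0, v (Ordinal t0) = f i0 /\ j = g j0.
    by apply: hP; case: (euv (Ordinal t0)).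
  have /fin_all_exists[w wP] k : exists w, v k = f w.1 /\ u k = g w.2.
    by case: (euv k) => _ /hP[x [y ?]] _; exists (x, y).
  apply: (tf i0 j0 (fun k => (w k).2) (fun k => (w k).1)).
  + by move=> k l kl; apply: uI; rewrite !(proj2 (wP _)) kl.
  + by move=> k l kl; apply: vI; rewrite !(proj1 (wP _)) kl.
  + by move=> k; have := uj k; rewrite (proj2 (wP _)) Ej inj_eq.
  + by move=> k; have := vi k; rewrite (proj1 (wP _)) Ei inj_eq.
  + by move=> k; have := euv k; rewrite (proj2 (wP _)) (proj1 (wP _)) Ei Ej !hE.
Qed.

(** * Counting three-edge paths *)

Section ThreePaths.
Variables (t : nat) (A B : finType) (E : {set A * B}).
Hypothesis t_gt0 : (0 < t)%N.
Hypotheses (rf : rectangle_free E) (tf : three_path_free t E).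

(** The path [i], [e.2], [e.1], [j] is recorded by its middle edge [e]. *)
Definition three_paths (i : A) (j : B) : {set A * B} :=
  [set e in E | [&& (i, e.2) \in E, (e.1, j) \in E, e.1 != i & e.2 != j]].

(** Two middle edges sharing just one end would close a rectangle with [i] or with [j], so distinct
    paths are internally disjoint. *)
Lemma card_three_paths i j : (#|three_paths i j| <= t.-1)%N.
Proof.
rewrite leqNgt prednK //; apply/negP => le_t.
pose g (k : 'I_t) := enum_val (widen_ord le_t k).
have gP k : g k \in three_paths i j by exact: enum_valP.
have gI : injective g by move=> k l /enum_val_inj /(congr1 val) /= /val_inj.
apply: (tf i j (fun k => (g k).2) (fun k => (g k).1)).
- move=> k l kl; apply: gI; move: (gP k) (gP l) kl.
  case: (g k) (g l) => [i1 j1] [i2 j2]; rewrite !inE /=.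
  move=> /andP[e1 /and4P[e2 e3 e4 e5]] /andP[e6 /and4P[e7 e8 e9 e10]] Ej.
  move: Ej e6 => <- e6; congr (_, _); apply/eqP/negPn/negP => n12.
  by apply: (rf i1 i2 j1 j).
- move=> k l kl; apply: gI; move: (gP k) (gP l) kl.
  case: (g k) (g l) => [i1 j1] [i2 j2]; rewrite !inE /=.
  move=> /andP[e1 /and4P[e2 e3 e4 e5]] /andP[e6 /and4P[e7 e8 e9 e10]] Ej.
  move: Ej e6 => <- e6; congr (_, _); apply/eqP/negPn/negP => n12.
  by apply: (rf i1 i j1 j2).
- by move=> k; have := gP k; rewrite inE => /andP[_ /and4P[]].
- by move=> k; have := gP k; rewrite inE => /andP[_ /and4P[]].
- move=> k; have := gP k.
  by rewrite inE -surjective_pairing => /andP[-> /and4P[-> ->]].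
Qed.

Definition degl (i : A) := #|[set j | (i, j) \in E]|.
Definition degr (j : B) := #|[set i | (i, j) \in E]|.

(** Double counting by middle edge: a path is fixed by another neighbour of each of its ends. *)
Lemma sum_three_paths :
  (\sum_(e in E) (degl e.1).-1 * (degr e.2).-1 <= t.-1 * (#|A| * #|B|))%N.
Proof.
have -> : (t.-1 * (#|A| * #|B|) = \sum_(ij : A * B) t.-1)%N.
  by rewrite sum_nat_const card_prod mulnC.
apply: leq_trans (leq_sum _ (fun ij _ => card_three_paths ij.1 ij.2)).
under [leqRHS]eq_bigr => ij _ do rewrite -sum1_card.
rewrite (exchange_big_dep (mem E)) /=; last first.
  by move=> ij e _; rewrite inE => /andP[].
apply: leq_sum => -[i' j'] e'E /=.
rewrite sum1_card.
have -> : (degl i').-1 = #|[set j | (i', j) \in E] :\ j'|.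
  by rewrite /degl (cardsD1 j') inE e'E.
have -> : (degr j').-1 = #|[set i | (i, j') \in E] :\ i'|.
  by rewrite /degr (cardsD1 i') inE e'E.
rewrite mulnC -cardsX; apply: subset_leq_card; apply/fintype.subsetP => -[i j].
rewrite !inE /= => /andP[/andP[n1 e1] /andP[n2 e2]].
have : (i', j') \in three_paths i j; last exact: id.
rewrite inE /= e'E e1 e2 /=.
by rewrite [i' == _]eq_sym [j' == _]eq_sym n1 n2.
Qed.

(** Degrees are taken in all of [E], so one round of pruning suffices; survivors have degrees
    strictly above [da] and [db], which absorbs the [.-1]. *)
Lemma card_rectangle_three_path_free da db :
  ((#|E| - (#|A| * da + #|B| * db)) * (da * db) <= t.-1 * (#|A| * #|B|))%N.
Proof.
apply: leq_trans sum_three_paths.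
pose EA := [set e in E | (degl e.1 <= da)%N].
pose EB := [set e in E | (degr e.2 <= db)%N].
have EA_le : (#|EA| <= #|A| * da)%N.
  rewrite -sum1_card (partition_big fst predT) //= -sum_nat_const.
  apply: leq_sum => i _; rewrite sum1_card.
  have [le_i|lt_i] := leqP (degl i) da; last first.
    rewrite eq_card0 // => -[i' j]; apply/negP => /andP[].
    by rewrite !inE /= => /andP[_ +] /eqP Ei; rewrite Ei leqNgt lt_i.
  apply: leq_trans le_i; rewrite /degl.
  rewrite -(card_imset (mem [set j | (i, j) \in E]) (f := pair i));
    last by move=> ? ? [].
  apply: subset_leq_card; apply/fintype.subsetP => -[i' j].
  case/andP; rewrite inE => /andP[eE _] /eqP /= Ei; apply/imsetP.
  by exists j; rewrite ?inE -Ei.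
have EB_le : (#|EB| <= #|B| * db)%N.
  rewrite -sum1_card (partition_big snd predT) //= -sum_nat_const.
  apply: leq_sum => j _; rewrite sum1_card.
  have [le_j|lt_j] := leqP (degr j) db; last first.
    rewrite eq_card0 // => -[i j']; apply/negP => /andP[].
    by rewrite !inE /= => /andP[_ +] /eqP Ej; rewrite Ej leqNgt lt_j.
  apply: leq_trans le_j; rewrite /degr.
  rewrite -(card_imset (mem [set i | (i, j) \in E]) (f := pair^~ j));
    last by move=> ? ? [].
  apply: subset_leq_card; apply/fintype.subsetP => -[i j'].
  case/andP; rewrite inE => /andP[eE _] /eqP /= Ej; apply/imsetP.
  by exists i; rewrite ?inE -Ej.
pose E' := E :\: (EA :|: EB).
have E'_ge : (#|E| - (#|A| * da + #|B| * db) <= #|E'|)%N.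
  rewrite cardsD leq_sub2l // (leq_trans (subset_leq_card (subsetIr _ _))) //.
  by rewrite (leq_trans (leq_card_setU _ _)) // leq_add.
apply: (@leq_trans (#|E'| * (da * db))); first by rewrite leq_mul2r E'_ge orbT.
pose F e := ((degl e.1).-1 * (degr e.2).-1)%N.
have E'E : E' \subset E by apply: subsetDl.
rewrite -sum_nat_const; apply: (@leq_trans (\sum_(e in E') F e)).
  apply: leq_sum => e; rewrite !inE negb_or => /andP[/andP[]] ++ eE.
  rewrite eE /= -!ltnNge => lA lB.
  by apply: leq_mul; rewrite -ltnS (leq_trans _ (leqSpred _)).
by rewrite [leqRHS](big_setID E') /= (finset.setIidPr E'E) leq_addr.
Qed.
End ThreePaths.

(** * The subfield of order q and the norm *)

Section NormHypersurface.
Variables (L : finFieldType) (q t : nat).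
Hypotheses (q_pchar : [pchar L].-nat q) (q_gt1 : (1 < q)%N).
Hypotheses (cardL : #|L| = (q ^ t)%N) (t_gt1 : (1 < t)%N).

(** The subfield F_q of [L], as the fixed points of the q-Frobenius. *)
Definition frob_fixed : pred L := fun x => x ^+ q == x.

Lemma frob_fixedM x y : frob_fixed x -> frob_fixed y -> frob_fixed (x * y).
Proof. by rewrite /frob_fixed exprMn => /eqP-> /eqP->. Qed.

Lemma frob_fixedV x : frob_fixed x -> frob_fixed x^-1.
Proof. by rewrite /frob_fixed exprVn => /eqP->. Qed.

Lemma frob_fixedD x y : frob_fixed x -> frob_fixed y -> frob_fixed (x + y).
Proof. by rewrite /frob_fixed exprDn_pchar // => /eqP-> /eqP->. Qed.

Lemma frob_fixedB x y : frob_fixed x -> frob_fixed y -> frob_fixed (x - y).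
Proof.
move=> fx /eqP fy; apply: frob_fixedD => //; apply/eqP.
apply/(addIr y); rewrite -[X in _ + X = _]fy -exprDn_pchar // addNr expr0n.
by case: q q_gt1.
Qed.

Lemma frob_fixedX x j : frob_fixed x -> x ^+ (q ^ j) = x.
Proof.
by move=> /eqP fx; elim: j => [|j IH]; rewrite ?expr1 // expnSr exprM IH.
Qed.

(* The roots of [X^q - X] number exactly [q] because it divides [X^(q^t) - X],
   which has all [q^t] elements of [L] as roots. *)
Lemma card_frob_fixed : #|frob_fixed| = q.
Proof.
pose p := 'X^q - 'X : {poly L}.
have sz_p n : (1 < n)%N -> size ('X^n - 'X : {poly L}) = n.+1.
  by move=> n1; rewrite size_polyDl ?size_polyN size_polyXn // size_polyX ltnS.
have p0 : p != 0 by rewrite -size_poly_gt0 sz_p.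
have rootp x : root p x = frob_fixed x.
  by rewrite /root !hornerE subr_eq0.
have q0 : (0 < q)%N by apply: ltnW.
have qt1 : (1 < q ^ t)%N by rewrite -(exp1n t) ltn_exp2r // ltnW.
have [g pg] : exists g : {poly L}, 'X^(q ^ t) - 'X = p * g.
  have [k qk] : exists k, ((q ^ t).-1 = q.-1 * k)%N.
    by exists (\sum_(i < t) q ^ i)%N; rewrite predn_exp.
  have e n : (0 < n)%N -> 'X^n - 'X = 'X * ('X^(n.-1) - 1) :> {poly L}.
    by move=> n0; rewrite mulrBr mulr1 -exprS prednK.
  exists (\sum_(i < k) ('X^(q.-1)) ^+ i).
  by rewrite /p !e ?(ltnW qt1) // qk exprM subrX1 mulrA.
have pg0 : p * g != 0 by rewrite -pg -size_poly_gt0 sz_p.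
have g0 : g != 0 by apply: contraNneq pg0 => ->; rewrite mulr0.
have sz : ((q + size g) = (q ^ t).+1)%N.
  by rewrite -sz_p // pg size_mul // sz_p.
have le_p : (#|frob_fixed| <= q)%N.
  rewrite cardE -ltnS -(sz_p q) //; apply: (max_poly_roots p0 _ (enum_uniq _)).
  by apply/allP => x; rewrite mem_enum rootp.
(* Elements outside F_q are roots of the cofactor [g], of degree q^t - q; at least q elements
   therefore remain inside. *)
have lt_g : (#|[predC frob_fixed]| < size g)%N.
  rewrite cardE; apply: (max_poly_roots g0 _ (enum_uniq _)).
  apply/allP => x; rewrite mem_enum /= inE => nx.
  have : root (p * g) x.
    by rewrite -pg /root !hornerE -cardL expf_card subrr.
  by rewrite rootM rootp => /orP[|//] /(negP nx).
apply/eqP; rewrite eqn_leq le_p /=.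
have := cardC frob_fixed; rewrite cardL => e.
rewrite -(leq_add2r (size g)) sz -e -addnS leq_add2l //.
Qed.

Definition field_norm (x : L) : L := \prod_(j < t) x ^+ (q ^ j).

(** Raising to the power [q] permutes the conjugates cyclically, as x^(q^t) = x. *)
Lemma field_norm_fixed x : frob_fixed (field_norm x).
Proof.
rewrite /frob_fixed /field_norm -prodrXl; apply/eqP.
case: t cardL t_gt1 => // m cL _.
under eq_bigr => j _ do rewrite -exprM -expnSr.
rewrite big_ord_recr [RHS]big_ord_recl /= -cL expf_card mulrC expr1.
by congr (_ * _); apply: eq_bigr.
Qed.

(** For l in F_q, each conjugate of x + l W is affine in l. The norm is thus a polynomial in l of
    degree t with leading coefficient N(W), and t > 1 keeps the degree after the affine right side
    is subtracted. *)
Lemma field_norm_secant x W Z (s : seq L) : W != 0 -> uniq s ->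
  (forall l, l \in s ->
    frob_fixed l /\ field_norm (x + l * W) = field_norm x + l * Z) ->
  (size s <= t)%N.
Proof.
move=> W0 us sP.
pose fac (j : 'I_t) : {poly L} := (W ^+ (q ^ j))%:P * 'X + (x ^+ (q ^ j))%:P.
have sz_fac j : size (fac j) = 2.
  by rewrite size_MXaddC polyC_eq0 expf_eq0 (negbTE W0) andbF /= size_polyC
       expf_eq0 (negbTE W0) andbF.
pose P := \prod_(j < t) fac j - (Z%:P * 'X + (field_norm x)%:P).
have szP : size P = t.+1.
  have szN : size (\prod_(j < t) fac j) = t.+1.
    rewrite size_prod => [|j _]; last by rewrite -size_poly_gt0 sz_fac.
    under eq_bigr => j _ do rewrite sz_fac.
    rewrite sum_nat_const card_ord muln2 -addnn -addSn addnK //.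
  rewrite size_polyDl szN // size_polyN (@leq_ltn_trans 2) //.
  by rewrite size_MXaddC; case: ifP => // _; rewrite ltnS size_polyC leq_b1.
rewrite -ltnS -szP; apply: max_poly_roots us.
  by rewrite -size_poly_gt0 szP.
apply/allP => l /sP[lF lN]; rewrite /root /P !hornerE horner_prod subr_eq0.
rewrite [Z * l]mulrC [eqbRHS]addrC -lN /field_norm; apply/eqP/eq_bigr => j _.
rewrite /fac !hornerE exprDn_pchar ?exprMn ?(frob_fixedX _ _ lF); last first.
  by rewrite pnatX q_pchar.
by rewrite addrC mulrC.
Qed.

(** * The point-line incidence graph *)

Local Notation F := {x : L | frob_fixed x}.

(* [(x, u, v)] is the line through [(0, u, v)] with direction
   [(1, x, field_norm x)]. *)
Definition norm_incidence : {set (L * L * F) * (F * L * F)} :=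
  [set e | let: ((x, u, v), (s, w, z)) := e in
    (w == u + val s * x) && (val z == val v + val s * field_norm x)].

Lemma norm_incidenceP x u v s w z :
  reflect (w = u + val s * x /\ val z = val v + val s * field_norm x)
    (((x, u, v), (s, w, z)) \in norm_incidence).
Proof. by rewrite inE; apply: (iffP andP) => -[/eqP-> /eqP->]. Qed.

(** Each line has a point for every parameter [s]; its last coordinate stays in F_q because norms
    do. *)
Lemma card_norm_incidence : (q ^ t * q ^ t * q * q <= #|norm_incidence|)%N.
Proof.
have fixz (l : L * L * F) (s : F) :
    frob_fixed (val l.2 + val s * field_norm l.1.1).
  by rewrite frob_fixedD ?frob_fixedM ?field_norm_fixed ?(valP l.2) ?(valP s).
pose h (ls : (L * L * F) * F) : (L * L * F) * (F * L * F) :=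
  let l := ls.1 in
  (l, (ls.2, l.1.2 + val ls.2 * l.1.1, Sub _ (fixz l ls.2))).
have hI : injective h by move=> [l s] [l' s'] [-> ->].
have <- : #|[set h e | e in [set: (L * L * F) * F]]|
    = (q ^ t * q ^ t * q * q)%N.
  rewrite card_imset // cardsT !card_prod cardL card_sig.
  by rewrite (eq_card (B := frob_fixed)) ?card_frob_fixed.
apply/subset_leq_card/fintype.subsetP => _ /imsetP[[[[x u] v] s] _ ->].
exact/norm_incidenceP.
Qed.

(** Distinct points of a line have distinct parameters, so two of them determine the slope [x], then
    [u] and [v]. *)
Lemma norm_incidence_rectangle_free : rectangle_free norm_incidence.
Proof.
move=> [[x u] v] [[x' u'] v'] [[s w] z] [[s' w'] z'] nl np.
move=> /norm_incidenceP[ew ez] /norm_incidenceP[ew' ez'].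
move=> /norm_incidenceP[e1 e2] /norm_incidenceP[e1' e2'].
rewrite ew in e1; rewrite ew' in e1'.
have [ss|ss] := eqVneq s s'.
  by case/eqP: np; congr (_, _, _); rewrite ?ew ?ew' ?ss //;
    apply: val_inj; rewrite ez ez' ss.
have ds : val s - val s' != 0 by rewrite subr_eq0 inj_eq //; apply: val_inj.
have xx : x = x'.
  apply: (mulfI ds).
  have -> : (val s - val s') * x = (u + val s * x) - (u + val s' * x) by ring.
  by rewrite e1 e1'; ring.
case/eqP: nl; congr (_, _, _) => //.
  by apply: (addIr (val s * x)); rewrite e1 xx.
by apply/val_inj/(addIr (val s * field_norm x)); rewrite -ez e2 xx.
Qed.

(* Writing [W], [Z] for the offset of the point from the line, the line meeting
   both at parameters [s], [s0] has direction [x + l * W], [l = (s0 - s)^-1],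
   and [field_norm (x + l * W) = field_norm x + l * Z]; the root [l = 0] is
   the line itself. *)
Lemma norm_incidence_three_path_free : three_path_free t norm_incidence.
Proof.
move=> [[x u] v] [[s0 w] z] p l pI lI pj li inc.
pose s k := (p k).1.1.
have ps k : exists w z, p k = (s k, w, z).
  by rewrite /s; case: (p k) => [[? ?] ?] /=; do 2 eexists.
pose W := w - u - val s0 * x; pose Z := val z - val v - val s0 * field_norm x.
pose lam k := (val s0 - val (s k))^-1.
(* With equal parameters, the two points of [l k] would coincide. *)
have ds k : val s0 - val (s k) != 0.
  rewrite subr_eq0; apply/eqP => /val_inj ss.
  move: (inc k) (pj k); case: (ps k) => wk [zk ->].
  case: (l k) => [[a b] c] [_ /norm_incidenceP[e1 e2] /norm_incidenceP[e3 e4]].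
  by case/eqP; rewrite -ss in e1 e2 *; congr (_, _, _); rewrite ?e1 ?e3 //;
    apply/val_inj; rewrite e2 e4.
have dir k : (l k).1.1 = x + lam k * W /\
    field_norm (l k).1.1 = field_norm x + lam k * Z.
  move: (inc k); case: (ps k) => wk [zk ->].
  case: (l k) => [[a b] c] [/norm_incidenceP[e1 e2] /norm_incidenceP[e3 e4]].
  move=> /norm_incidenceP[e5 e6] /=; rewrite /lam /W /Z e5 e6.
  have eb : b = u + val (s k) * x - val (s k) * a by rewrite -e1 e3 addrK.
  have ec : val c = val v + val (s k) * field_norm x - val (s k) * field_norm a.
    by rewrite -e2 e4 addrK.
  by rewrite eb ec; split; field; apply: ds.
have lam_inj : injective lam.
  move=> k m /invr_inj /addrI/oppr_inj/val_inj skm; apply: pI.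
  move: (inc k) (inc m); case: (ps k) (ps m) => wk [zk ->] [wm [zm ->]].
  move=> [/norm_incidenceP[e1 e2] _ _] [/norm_incidenceP[e3 e4] _ _].
  by congr (_, _, _) => //; rewrite ?e1 ?e3 ?skm //;
    apply/val_inj; rewrite e2 e4 skm.
(* If W = 0, then [l k] has direction [x] and the norm equation forces Z = 0; the end point is on
   the initial line, which then equals [l k]. *)
have W0 : W != 0.
  apply/eqP => W0; pose k := Ordinal (ltnW t_gt1).
  have [] := dir k; rewrite W0 mulr0 addr0 => -> /esym/eqP.
  rewrite -subr_eq0 addrAC subrr add0r mulf_eq0 invr_eq0 (negbTE (ds k)) /=.
  move=> /eqP Z0.
  have [] := dir k; rewrite W0 mulr0 addr0 => lx _.
  move: (inc k) (li k) lx.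
  case: (l k) => [[a b] c] /= [_ _ /norm_incidenceP[e1 e2]].
  move=> + ax; case/eqP; congr (_, _, _) => //.
    by move: W0; rewrite /W e1 ax => /eqP;
      rewrite addrAC addrK subr_eq0 => /eqP.
  by apply: val_inj; move: Z0; rewrite /Z e2 ax => /eqP;
    rewrite addrAC addrK subr_eq0 => /eqP.
have := @field_norm_secant x W Z (0 :: [seq lam k | k <- enum 'I_t]) W0.
rewrite /= size_map size_enum_ord ltnn => H; suff: false by []; apply: H.
  rewrite map_inj_uniq // enum_uniq andbT; apply/mapP => -[k _ /esym/eqP].
  by rewrite invr_eq0 (negbTE (ds k)).
move=> m; rewrite inE => /orP[/eqP->|/mapP[k _ ->]].
  by rewrite !mul0r !addr0; split=> //;
    rewrite /frob_fixed expr0n; case: q q_gt1.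
split; first by rewrite frob_fixedV ?frob_fixedB ?(valP (s k)) ?(valP s0).
by have [<-] := dir k.
Qed.
End NormHypersurface.

(** * Bounds on [ex] and the choice of parameters *)

Lemma ex_ge_pow2 t k a b : (1 < t)%N -> (0 < k)%N ->
  ((2 ^ k) ^ (2 * t + 1) <= a)%N -> ((2 ^ k) ^ (t + 2) <= b)%N ->
  ((2 ^ k) ^ (2 * t + 2) <= ex a b (C4_theta3 t))%N.
Proof.
move=> t1 k0 qa qb; have t0 := ltnW t1; set q := (2 ^ k)%N in qa qb *.
have kt : (0 < k * t)%N by rewrite muln_gt0 k0.
have [L charL cardL] := pPrimePowerField (isT : prime 2) kt.
rewrite expnM -/q in cardL.
have q_pchar : [pchar L].-nat q.
  by rewrite pnatX (eq_pnat _ (pcharf_eq charL)) pnat_id.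
have q1 : (1 < q)%N by rewrite -(exp1n k) ltn_exp2r.
have cardF : #|{: {x : L | frob_fixed L q x}}| = q.
  rewrite card_sig (eq_card (B := frob_fixed L q)) //.
  exact: (card_frob_fixed L q t).
apply: (leq_trans _ (ex_ge_card t _ _ (norm_incidence L q t) a b t0 _ _ _ _)).
- apply: leq_trans (card_norm_incidence L q t q_pchar q1 cardL t1).
  by rewrite -expnD -!expnSr addnn -mul2n addn2.
- by rewrite !card_prod cardF cardL -expnD -expnSr addnn -mul2n -addn1.
- by rewrite !card_prod cardF cardL -expnS -expnSr -addn2.
- exact: norm_incidence_rectangle_free.
- exact: norm_incidence_three_path_free.
Qed.

Lemma ex_le_count t a b da db : (0 < t)%N ->
  ((ex a b (C4_theta3 t) - (a * da + b * db)) * (da * db) <= t.-1 * (a * b))%N.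
Proof.
move=> t0; rewrite /ex.
(* The inequality holds at 0 and passes to maxima, so it is enough to treat one edge set. *)
elim/big_ind: _ => [|m n Hm Hn|E /asboolP Ef].
- by rewrite sub0n.
- by rewrite /maxn; case: ifP.
have := card_rectangle_three_path_free t _ _ E t0
  (free_of_rectangle_free _ _ _ _ Ef)
  (free_of_three_path_free _ _ _ _ Ef) da db.
by rewrite !card_ord.
Qed.

Theorem theorem1p2 (R : realType) (t : nat) (ht : (2 <= t)%N) :
  exists c1 c2 : R, 0 < c1 /\ 0 < c2 /\
  exists n0 : nat, forall n : nat, (n0 <= n)%N ->
    let b := Num.truncn (n%:R `^ ((t%:R + 2) / (2 * t%:R + 1)) : R) in
    c1 * n%:R `^ (1 + 1 / (2 * t%:R + 1))
      <= (ex n b (C4_theta3 t))%:R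
      <= c2 * n%:R `^ (1 + 1 / (2 * t%:R + 1)).
Proof.
(* The first constant comes from q >= x/2; the second is 4 for pruned edges plus t - 1 for the
   others. *)
exists (2^-1 ^+ (2 * t + 2)), (t%:R + 3); split;
  first by rewrite exprn_gt0 ?invr_gt0.
split; first by rewrite ltr_wpDl.
(* This threshold gives x >= 2, hence [0 < k] below. *)
exists (2 ^ (2 * t + 1))%N => n n_ge.
set b := Num.truncn _; cbv zeta.
set d : R := 2 * t%:R + 1 in b *.
have d0 : d != 0 by rewrite gt_eqF // ltr_wpDl // mulr_ge0 ?ler0n.
pose x : R := n%:R `^ d^-1.
have x_ge0 : 0 <= x by exact: powR_ge0.
have powx m : n%:R `^ (m%:R / d) = x ^+ m.
  by rewrite mulrC powRrM powR_mulrn.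
have nx : n%:R = x ^+ (2 * t + 1).
  by rewrite -powx natrD natrM -/d divff // powRr1.
have {}powx2 : n%:R `^ (1 + 1 / d) = x ^+ (2 * t + 2).
  by rewrite -powx; congr (_ `^ _); rewrite natrD natrM /d; field.
have bE : b = Num.truncn (x ^+ (t + 2)) by rewrite /b -powx natrD.
rewrite powx2 {powx2}.
have x_ge2 : 2 <= x.
  have n0 : (0 < 2 * t + 1)%N by rewrite addn1.
  by rewrite -(ler_pXn2r n0) ?nnegrE // -nx -natrX ler_nat.
have x_gt0 : 0 < x by apply: lt_le_trans x_ge2.
have t0 : (0 < t)%N by apply: ltnW.
apply/andP; split.
- have m_gt1 : (1 < Num.truncn x)%N by rewrite truncn_gt_nat.
  (* q = 2^k is the largest power of 2 up to x, so x/2 <= q <= x. *)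
  set k := trunc_log 2 (Num.truncn x).
  have k0 : (0 < k)%N by rewrite trunc_log_gt0.
  have kx : ((2 ^ k)%N)%:R <= x.
    by rewrite -truncn_ge_nat // trunc_logP // ltnW.
  have xk : x <= 2 * ((2 ^ k)%N)%:R.
    rewrite -natrM -expnS ltW // -truncn_lt_nat //.
    exact: trunc_log_ltn.
  apply: le_trans (_ : (((2 ^ k) ^ (2 * t + 2))%N)%:R <= _).
    rewrite natrX -exprMn lerXn2r ?nnegrE ?mulr_ge0 ?invr_ge0 //.
    by rewrite ler_pdivrMl.
  rewrite ler_nat; apply: ex_ge_pow2 => //.
    by rewrite -(ler_nat R) nx natrX lerXn2r ?nnegrE.
  by rewrite bE truncn_ge_nat ?exprn_ge0 // natrX lerXn2r ?nnegrE.
- set e := ex n b _.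
  have bx : b%:R <= x ^+ (t + 2) by rewrite bE truncn_le exprn_ge0.
  (* Rounding up gives x <= da <= 2x and x^t <= db <= 2x^t: the upper bounds limit the pruned edges,
     the lower ones serve in [count]. *)
  pose da := (Num.truncn x).+1; pose db := (Num.truncn (x ^+ t)).+1.
  have x_ge1 : 1 <= x by apply: le_trans x_ge2; rewrite ler1n.
  have da_ge : x <= da%:R by rewrite ltW // truncnS_gt.
  have db_ge : x ^+ t <= db%:R by rewrite ltW // truncnS_gt.
  have da_le : da%:R <= 2 * x.
    by rewrite (mulr_natl x 2) mulr2n /da -natr1 lerD // truncn_le.
  have db_le : db%:R <= 2 * x ^+ t.
    rewrite (mulr_natl _ 2) mulr2n /db -natr1.
    by rewrite lerD ?exprn_ege1 // truncn_le exprn_ge0.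
  have adb : (n * da + b * db)%:R <= 4 * x ^+ (2 * t + 2).
    rewrite natrD !natrM.
    have -> : 4 * x ^+ (2 * t + 2) =
        x ^+ (2 * t + 1) * (2 * x) + x ^+ (t + 2) * (2 * x ^+ t).
      by rewrite mul2n -addnn !exprD; ring.
    by rewrite nx lerD // ler_pM ?ler0n // exprn_ge0.
  have e_le : (e <= (n * da + b * db) + (e - (n * da + b * db)))%N.
    by rewrite -leq_subLR.
  rewrite -(ler_nat R) natrD in e_le; apply: le_trans e_le _.
  have -> : t%:R + 3 = 4 + t.-1%:R :> R.
    by rewrite -[in LHS](prednK t0) -natr1; ring.
  rewrite mulrDl lerD //.
  have count := ex_le_count t n b da db t0.
  rewrite -/e -(ler_nat R) !natrM in count.
  rewrite -(@ler_pM2r _ (x * x ^+ t)) ?mulr_gt0 ?exprn_gt0 //.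
  apply: le_trans (_ : _ <= (e - (n * da + b * db))%:R * (da%:R * db%:R)) _.
    by rewrite ler_wpM2l // ler_pM // exprn_ge0.
  apply: le_trans count _.
  rewrite -mulrA ler_wpM2l // nx.
  have -> : x ^+ (2 * t + 2) * (x * x ^+ t) = x ^+ (2 * t + 1) * x ^+ (t + 2).
    by rewrite -exprS -!exprD; congr (x ^+ _); lia.
  by rewrite ler_wpM2l // exprn_ge0.
Qed.
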